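(* Let $m,n \in \mathbb{N}^*$ and $G \simeq C_m \oplus C_{mn}$. For every zero-sumfree sequence $S$ in $G$ with $|S| \geq m+mn-2$, one has $$\mathsf{k}(S) \leq \frac{m-1}{m}+\frac{mn-1}{mn}.$$ In particular, $\mathsf{k}(S) < 2$.
   Context: $C_k$ denotes the cyclic group of order $k$. A sequence in a finite abelian group $G$ (written additively) is a finite list $S=(g_1,\dots,g_\ell)$ of elements of $G$ (repetitions allowed), of length $|S|=\ell$. $S$ is zero-sumfree if $\sum_{i\in I} g_i \neq 0$ for every non-empty $I \subseteq \{1,\dots,\ell\}$. The cross number of $S$ is $\mathsf{k}(S)=\sum_{i=1}^{\ell} \frac{1}{\mathrm{ord}(g_i)}$. *)

(* Defs.v *)
From mathcomp Require Export all_boot all_order all_fingroup all_algebra.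

Set Implicit Arguments.
Unset Strict Implicit.
Unset Printing Implicit Defensive.

Import GRing.Theory Num.Theory.
Local Open Scope ring_scope.

Section Sequences.
Variable G : finZmodType.
Implicit Type S : seq G.

(* The subsequences range over sets of positions, so repeated terms count with
   multiplicity. *)
Definition zero_sumfree S : Prop :=
  forall I : {set 'I_(size S)}, I != set0 -> \sum_(i in I) S`_i != 0.

(* #[g] is the order of g in the additive group of G, whose group law is +%R. *)
Definition cross_number S : rat := \sum_(g <- S) (#[g]%g%:R)^-1.

End Sequences.

(* C_r (+) C_s as a group, for r, s >= 1.  Zp r is cyclic of order r for every
   r >= 1, while the type 'Z_1 that carries Zp 1 has two elements. *)
Definition cyclic_sum (r s : nat) : {group 'Z_r * 'Z_s} :=
  [group of setX (Zp r) (Zp s)].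

(* Main.v *)
Require Import Defs.
From mathcomp Require Import cyclic zify ring lra.

(* Write the terms of S as pairs of coordinates modulo m and mn.  Disjoint
   zero-sum subsequences ("blocks") of the image of S in a quotient G/H have
   their sums in H, so having D(H) of them contradicts zero-sumfreeness.  With
   D(C_m + C_mn) = m + mn - 1 (itself obtained in this way with H = pG, by
   induction on m) and the short zero-sum subsequences in C_p + C_p and C_b,
   this gives, for |S| >= m + mn - 2:
   - with H = pG for a prime p | m: no term of S lies in pG, hence every order
     is a multiple of m;
   - with H = {g | (mn/b) g = 0} for 1 < b | n: at most m - 1 terms lie in H.
   Summing the second bound over the multiples m j, 0 <= j < n, bounds
   the sum of mn / ord(g), that is, mn times the cross number. *)

Set Implicit Arguments.
Unset Strict Implicit.
Unset Printing Implicit Defensive.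

Import Order.TTheory GRing.Theory Num.Theory.

Local Open Scope ring_scope.

(** * Alternating sums over subsets and the elementary abelian case *)

Section AlternatingSums.
Variables (R : comNzRingType) (I J : finType).

Lemma alt_sum_subset (A : {set I}) (i : I) (w : {set I} -> R) :
    i \in A -> (forall B, w (i |: B) = w B) ->
  \sum_(B : {set I} | B \subset A) (-1) ^+ #|B| * w B = 0.
Proof.
move=> Ai wi; rewrite (bigID (fun B : {set I} => i \in B)) /=.
rewrite (reindex_onto (fun B => i |: B) (fun B => B :\ i)) /=; last first.
  by move=> B /andP[_ iB]; rewrite setD1K.
rewrite (eq_bigl (fun B : {set I} => (B \subset A) && (i \notin B))) => [|B].
  rewrite -big_split big1 //= => B /andP[_ niB].
  by rewrite wi cardsU1 niB exprS mulN1r mulNr addNr.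
rewrite subUset sub1set Ai setU11 andbT /=; congr andb.
by apply/eqP/idP => [<-|/setU1K//]; rewrite !inE eqxx.
Qed.

(* Each monomial of the expanded product involves at most #|J| indices, so it
   misses some i in A, and toggling i in B cancels the terms in pairs. *)
Lemma alt_sum_prod_affine (c : J -> R) (a : J -> I -> R) (A : {set I}) :
    (#|J| < #|A|)%N ->
  \sum_(B : {set I} | B \subset A)
     (-1) ^+ #|B| * \prod_j (c j + \sum_(i in B) a j i) = 0.
Proof.
move=> ltJA.
(* [None] picks the constant term of factor [j], [Some i] its term at [i]; monomials are then
   functions from [J] to [option I]. *)
pose F (B : {set I}) j (o : option I) :=
  if o is Some i then (if i \in B then a j i else 0) else c j.
have defF (B : {set I}) j : c j + \sum_(i in B) a j i = \sum_o F B j o.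
  rewrite (bigD1 None) //= (reindex_omap Some id) /=; last by case.
  by congr (_ + _); rewrite big_mkcond; apply: eq_bigl => i; rewrite /= eqxx.
under eq_bigr => B _ do
  rewrite (eq_bigr _ (fun j _ => defF B j)) bigA_distr_bigA big_distrr.
rewrite exchange_big big1 // => f _ /=.
have /subsetPn[i Ai /negP nfi] : ~~ (A \subset [set i | Some i \in codom f]).
  have injS : injective (@Some I) by move=> ? ? [].
  apply: contraL ltJA => /subset_leq_card leA; rewrite -leqNgt.
  apply: leq_trans leA _; rewrite -(card_imset _ injS).
  rewrite -(size_codom f); apply: leq_trans (card_size _).
  apply/subset_leq_card/subsetP => o.
  by case/imsetP=> i; rewrite inE => ? ->.
apply: (@alt_sum_subset A i (fun B => \prod_j F B j (f j)) Ai) => B.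
apply: eq_bigr => j _; rewrite /F.
case Dfj: (f j) => [i'|//]; rewrite !inE; case: eqP => // Di.
by case: nfi; rewrite inE -Di -Dfj codom_f.
Qed.

End AlternatingSums.

(* The product over j and c != 0 of (l_j - c) is nonzero exactly where all the
   linear forms l_j vanish; if only set0 did so, its alternating sum over the
   subsets of A would be nonzero. *)
Lemma davenport_elementary_abelian (p : nat) (I J : finType)
    (x : J -> I -> nat) (A : {set I}) : prime p ->
    (#|J| * p.-1 < #|A|)%N ->
  exists B : {set I}, [/\ B \subset A, B != set0
    & forall j, p %| \sum_(i in B) x j i]%N.
Proof.
move=> p_pr ltA; pose K := (J * {c : 'F_p | c != 0})%type.
have cardK : #|{: K}| = (#|J| * p.-1)%N.
  by rewrite card_prod card_sig (eq_card (B := predC1 0)) // cardC1 card_Fp.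
have := @alt_sum_prod_affine 'F_p I K (fun k => - val k.2)
  (fun k i => (x k.1 i)%:R) A; rewrite cardK => /(_ ltA).
have [/existsP[B /and3P[sBA nzB /forallP xB]] _|noB] :=
  boolP [exists B : {set I}, [&& B \subset A, B != set0
    & [forall j, p %| \sum_(i in B) x j i]]]%N; first by exists B.
move/eqP; rewrite (bigD1 set0) ?sub0set //= [X in _ + X]big1 ?addr0.
  rewrite cards0 expr0 mul1r prodf_seq_eq0 => /hasP[[j [c nzc]] _] /=.
  by rewrite big_set0 addr0 oppr_eq0 (negPf nzc).
move=> B /andP[sBA nzB]; apply/eqP; rewrite mulf_eq0; apply/orP; right.
move: noB; rewrite negb_exists => /forallP/(_ B).
rewrite sBA nzB /= negb_forall => /existsP[j pB].
rewrite prodf_seq_eq0; apply/hasP.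
have nz : (\sum_(i in B) (x j i)%:R : 'F_p) != 0.
  by rewrite -natr_sum -(dvdn_pcharf (pchar_Fp p_pr)).
exists (j, exist (fun c => c != 0) _ nz); first by rewrite mem_index_enum.
by rewrite /= addrC subrr.
Qed.

Lemma take_enum_subset (I : finType) (A : {set I}) (k : nat) :
  [set i in take k (enum A)] \subset A.
Proof.
by apply/subsetP => i; rewrite inE => /mem_take; rewrite mem_enum.
Qed.

Lemma card_take_enum (I : finType) (A : {set I}) (k : nat) :
  (k <= #|A|)%N -> #|[set i in take k (enum A)]| = k.
Proof.
move=> leA; rewrite cardsE; have /card_uniqP-> : uniq (take k (enum A)).
  exact/take_uniq/enum_uniq.
by rewrite size_takel // -cardE.
Qed.

Lemma exists_subset_card (I : finType) (A : {set I}) (k : nat) :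
  (k <= #|A|)%N -> exists2 B : {set I}, B \subset A & #|B| = k.
Proof.
move=> leA; exists [set i in take k (enum A)]; last exact: card_take_enum.
exact: take_enum_subset.
Qed.

(** * Extraction of disjoint zero-sum blocks *)

Section Blocks.
Variable I : finType.
Implicit Types (A B C : {set I}) (Q : pred {set I}) (x y : I -> nat).

(** Coordinates are natural numbers, not residues, so that block sums can later be divided by [r]
    and [s]. *)
Definition zero_sum_mod r s x y B :=
  ((r %| \sum_(i in B) x i) && (s %| \sum_(i in B) y i))%N.

(** As a set of sets, the family can itself index a new sequence, with one term per block. *)
Definition has_blocks Q A N : Prop :=
  exists P : {set {set I}}, [/\ trivIset P, set0 \notin P, cover P \subset A,
    {in P, forall B, Q B} & (N <= #|P|)%N].

Lemma has_blocks0 Q A : has_blocks Q A 0.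
Proof.
exists set0; split=> [|||B|//]; rewrite ?inE //.
  by apply/trivIsetP => ?; rewrite inE.
by rewrite /cover big_set0 sub0set.
Qed.

Lemma has_blocksS Q A B N : B \subset A -> B != set0 -> Q B ->
  has_blocks Q (A :\: B) N -> has_blocks Q A N.+1.
Proof.
move=> sBA nzB QB [P [tP nP0 sPA QP leN]].
have sP C : C \in P -> C \subset A :\: B.
  by move=> CP; apply: subset_trans sPA; apply: bigcup_sup CP.
have [|tBP nBP] := trivIsetU1 (A := B) _ tP nP0.
  move=> C /sP; rewrite disjoint_sym disjoints_subset setDE subsetI.
  by case/andP.
exists (B |: P); split => //.
- by rewrite !inE eq_sym negb_or nzB.
- apply/bigcupsP => C /setU1P[-> //|/sP/subset_trans]; apply.
  exact: subsetDl.
- by move=> C /setU1P[-> //|]; apply: QP.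
by rewrite cardsU1 nBP.
Qed.

Lemma has_blocks_singletons Q A C N :
    C \subset A -> {in C, forall i, Q [set i]} -> has_blocks Q (A :\: C) N ->
  has_blocks Q A (#|C| + N).
Proof.
have [k] := ubnP #|C|; elim: k A C N => // k IHk A C N leCk sCA QC.
have [->|[i Ci]] := set_0Vmem C; first by rewrite setD0 cards0.
move=> blk; have Ai := subsetP sCA i Ci; rewrite (cardsD1 i) Ci.
apply: (@has_blocksS _ _ [set i]); rewrite ?sub1set ?QC //.
  by apply/set0Pn; exists i; rewrite inE.
apply: IHk; first by rewrite (cardsD1 i) Ci in leCk.
- exact: setSD.
- by move=> j /setD1P[_ /QC].
by rewrite setDDl setD1K.
Qed.

Lemma has_blocks_greedy Q w A N :
    (forall A, (w <= #|A|)%N ->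
       exists B, [/\ B \subset A, B != set0, Q B & (#|B| <= w)%N]) ->
  (N * w <= #|A|)%N -> has_blocks Q A N.
Proof.
move=> short; elim: N A => [|N IHN] A leA; first exact: has_blocks0.
have [|B [sBA nzB QB leBw]] := short A; first by rewrite mulSn in leA; lia.
apply: (@has_blocksS Q A B N) => //; apply: IHN.
by rewrite cardsDS //; rewrite mulSn in leA; lia.
Qed.

Lemma zero_sum_modD r s x y A B : B \subset A -> zero_sum_mod r s x y A ->
  zero_sum_mod r s x y B -> zero_sum_mod r s x y (A :\: B).
Proof.
move=> sBA /andP[rA sA] /andP[rB sB].
rewrite (big_setID B) (setIidPr sBA) /= in rA.
rewrite (big_setID B) (setIidPr sBA) /= in sA.
by rewrite dvdn_addr // in rA; rewrite dvdn_addr // in sA; apply/andP.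
Qed.

Lemma card_has_zero_sum_prime p x y A : prime p -> (2 * p <= #|A|.+1)%N ->
  exists B, [/\ B \subset A, B != set0 & zero_sum_mod p p x y B].
Proof.
move=> p_pr leA; have p_gt1 := prime_gt1 p_pr.
have [|B [sBA nzB pB]] := @davenport_elementary_abelian p I bool
  (fun b => if b then x else y) A p_pr; first by rewrite card_bool; lia.
by exists B; split=> //; rewrite /zero_sum_mod (pB true) (pB false).
Qed.

(* A constant third coordinate forces the length of a zero-sum subsequence to
   be p or 2p; in the second case it splits into two zero-sum parts. *)
Lemma short_zero_sum_prime p x y A : prime p -> (3 * p <= #|A| + 2)%N ->
  exists B, [/\ B \subset A, B != set0, zero_sum_mod p p x y B
    & (#|B| <= p)%N].
Proof.
move=> p_pr leA; have p_gt1 := prime_gt1 p_pr.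
(* One more than 3(p - 1), as three linear forms require, and less than 3p, which excludes a
   zero-sum of length 3p. *)
have [A' sA'A cA'] : exists2 A' : {set I}, A' \subset A & #|A'| = (3 * p - 2)%N.
  by apply: exists_subset_card; lia.
pose X (j : option bool) : I -> nat :=
  match j with Some true => x | Some false => y | None => fun=> 1%N end.
have [|B [sBA' nzB pB]] := @davenport_elementary_abelian p I _ X A' p_pr.
  by rewrite card_option card_bool cA'; lia.
have sBA := subset_trans sBA' sA'A.
have zB : zero_sum_mod p p x y B.
  by rewrite /zero_sum_mod (pB (Some true)) (pB (Some false)).
have [leBp|ltpB] := leqP #|B| p; first by exists B.
have cB : #|B| = (2 * p)%N.
  have /dvdnP[q Dq] : (p %| #|B|)%N by rewrite -sum1_card; apply: (pB None).
  have : (#|B| <= 3 * p - 2)%N by rewrite -cA' subset_leq_card.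
  by case: q Dq => [|[|[|q]]]; rewrite ?mulSn; lia.
(* Setting [i] aside leaves 2p - 1 indices, enough for a zero-sum [C], and keeps the complement of
   [C] in [B] non-empty. *)
have /set0Pn[i Bi] := nzB.
have [|C [sCB nzC zC]] := @card_has_zero_sum_prime p x y (B :\ i) p_pr.
  by rewrite (cardsD1 i) Bi in cB; lia.
have iC : i \notin C by apply/negP => /(subsetP sCB); rewrite !inE eqxx.
have {}sCB := subset_trans sCB (subsetDl B [set i]).
have cBC := cardsDS sCB; have leCB := subset_leq_card sCB.
have [leCp|ltpC] := leqP #|C| p.
  by exists C; split=> //; apply: subset_trans sBA.
exists (B :\: C); split; last by lia.
- exact: subset_trans (subsetDl _ _) sBA.
- by apply/set0Pn; exists i; rewrite inE iC.
exact: zero_sum_modD.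
Qed.

(** Blocks of length at most p are removed one by one; the last may have any length, so 2p - 1
    indices suffice for it instead of 3p - 2. *)
Lemma has_blocks_prime p x y A N : prime p -> (p + N * p <= #|A|.+1)%N ->
  has_blocks (zero_sum_mod p p x y) A N.
Proof.
move=> p_pr; elim: N A => [|N IHN] A leA; first exact: has_blocks0.
have p_gt1 := prime_gt1 p_pr; rewrite mulSn in leA.
case: (posnP N) => [N0|N_gt0].
  have [|B [sBA nzB zB]] := @card_has_zero_sum_prime p x y A p_pr.
    by rewrite N0 in leA; lia.
  by rewrite N0; apply: has_blocksS sBA nzB zB (has_blocks0 _ _).
have [|B [sBA nzB zB leBp]] := @short_zero_sum_prime p x y A p_pr; first by nia.
by apply: (@has_blocksS _ A B N) => //; apply: IHN; rewrite cardsDS //; lia.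
Qed.

(** Pigeonhole: of the n + 1 initial segments of [A] of length 0 to n, two have equal sums modulo n,
    and their difference is [B]. *)
Lemma davenport_cyclic n y A : (0 < n)%N -> (n <= #|A|)%N ->
  exists B, [/\ B \subset A, B != set0, (n %| \sum_(i in B) y i)%N
    & (#|B| <= n)%N].
Proof.
move=> n_gt0 leA; pose C k := [set i in take k (enum A)].
have sC j k : (j <= k)%N -> C j \subset C k.
  move=> le_jk; apply/subsetP => i; rewrite !inE => Ci.
  by rewrite -(subnKC le_jk) takeD mem_cat Ci.
have cC k : (k <= n)%N -> #|C k| = k.
  by move=> le_kn; apply/card_take_enum/(leq_trans le_kn).
pose f (k : 'I_n.+1) : 'I_n := Ordinal (ltn_pmod (\sum_(i in C k) y i) n_gt0).
have /injectivePn[j [k njk Efjk]] : ~~ injectiveb f.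
  by apply/negP => /injectiveP/leq_card; rewrite !card_ord ltnn.
wlog lt_jk : j k njk Efjk / (j < k)%N.
  move=> IH; case: (ltngtP j k) => [|ltkj|/ord_inj Ejk]; first exact: IH.
    by apply: (IH k j) => //; rewrite eq_sym.
  by rewrite Ejk eqxx in njk.
have [len_j len_k] : (j <= n /\ k <= n)%N by split; rewrite -ltnS.
have sCjk := sC _ _ (ltnW lt_jk).
have cD : #|C k :\: C j| = (k - j)%N by rewrite cardsDS // !cC.
exists (C k :\: C j); split.
- exact: subset_trans (subsetDl _ _) (take_enum_subset A k).
- by rewrite -card_gt0 cD subn_gt0.
- move/(congr1 val): Efjk => /= /eqP.
  rewrite [X in (_ == X %[mod _])%N](big_setID (C j)) (setIidPr sCjk) /= eq_sym.
  by rewrite -[X in (_ == X %[mod _])%N]addn0 eqn_modDl mod0n.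
by rewrite cD; lia.
Qed.

Lemma has_blocks_cyclic n x y A N : (0 < n)%N -> (N * n <= #|A|)%N ->
  has_blocks (zero_sum_mod 1 n x y) A N.
Proof.
move=> n_gt0; apply: has_blocks_greedy => {}A leA.
have [B [sBA nzB nB leBn]] := @davenport_cyclic n y A n_gt0 leA.
by exists B; split=> //; rewrite /zero_sum_mod dvd1n.
Qed.

End Blocks.

(** * The Davenport constant in rank two *)

Definition davenport_le r s N : Prop :=
  forall (I : finType) (x y : I -> nat) (A : {set I}), (N <= #|A|)%N ->
  exists B : {set I}, [/\ B \subset A, B != set0 & zero_sum_mod r s x y B].

(** Block sums divided by [r] and [s] form a sequence indexed by the blocks; the union of a zero-sum
    set of blocks modulo [r'] and [s'] is the desired [B]. *)
Lemma has_blocks_davenport (I : finType) (x y : I -> nat) (A : {set I})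
    (r s r' s' N : nat) : (0 < r)%N -> (0 < s)%N ->
    davenport_le r' s' N -> has_blocks (zero_sum_mod r s x y) A N ->
  exists B : {set I}, [/\ B \subset A, B != set0
    & zero_sum_mod (r * r') (s * s') x y B].
Proof.
move=> r_gt0 s_gt0 dav [P [tP nP0 sPA zP leN]].
pose sum_div q (z : I -> nat) (B : {set I}) := ((\sum_(i in B) z i) %/ q)%N.
have [Q [sQP nzQ /andP[rQ sQ]]] := dav _ (sum_div r x) (sum_div s y) P leN.
have tQ := trivIsetS sQP tP; exists (cover Q); split.
- by apply: subset_trans sPA; apply/bigcupsP => B /(subsetP sQP)/bigcup_sup->.
- have /set0Pn[B QB] := nzQ; apply/eqP => Q0.
  have : B \subset cover Q by apply: bigcup_sup QB.
  rewrite Q0 subset0 => /eqP B0.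
  by move: nP0; rewrite -B0 (subsetP sQP).
rewrite /zero_sum_mod !big_trivIset //=.
rewrite (eq_bigr (fun B => r * sum_div r x B)%N); last first.
  by move=> B /(subsetP sQP)/zP/andP[rB _]; rewrite mulnC divnK.
rewrite [X in _ && (_ %| X)%N](eq_bigr (fun B => s * sum_div s y B)%N).
  by rewrite -!big_distrr /= !dvdn_pmul2l // rQ.
by move=> B /(subsetP sQP)/zP/andP[_ sB]; rewrite mulnC divnK.
Qed.

(** For m = pq, the identity p + (q + qn - 1)p = m + mn yields just the q + qn - 1 blocks that the
    induction hypothesis asks for; m = 1 is the cyclic case. *)
Lemma davenport_rank2 m n : (0 < m)%N -> (0 < n)%N ->
  davenport_le m (m * n) (m + m * n).-1.
Proof.
have [k] := ubnP m; elim: k m => // k IHk m ltmk m_gt0 n_gt0 I x y A leA.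
case: (ltngtP m 1) => [|m_gt1|m1]; first by rewrite ltnNge m_gt0.
  pose p := pdiv m; have p_pr : prime p := pdiv_prime m_gt1.
  have p_gt1 := prime_gt1 p_pr; have /dvdnP[q Dm] : (p %| m)%N := pdiv_dvd m.
  have q_gt0 : (0 < q)%N by move: m_gt0; rewrite Dm muln_gt0 => /andP[].
  have ltqm : (q < m)%N by rewrite Dm -[X in (X < _)%N]muln1 ltn_pmul2l.
  have [|//|] := has_blocks_davenport (x := x) (y := y) (A := A)
    (ltnW p_gt1) (ltnW p_gt1) (IHk q _ q_gt0 n_gt0).
  - exact: leq_trans ltqm _.
  - by apply: has_blocks_prime => //; nia.
  by move=> B; rewrite mulnA [(p * q)%N]mulnC -Dm => ?; exists B.
have [|B [sBA nzB nB _]] := @davenport_cyclic I n y A n_gt0.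
  by rewrite m1 mul1n add1n in leA.
by exists B; split; rewrite // /zero_sum_mod m1 dvd1n mul1n.
Qed.

(** * Divisibility of the terms of long zero-sumfree sequences *)

Section LongSequences.
Variables (m n : nat) (I : finType) (x y : I -> nat) (A : {set I}).
Hypotheses (m_gt0 : (0 < m)%N) (n_gt0 : (0 < n)%N).
Hypothesis zsf : forall B : {set I}, B \subset A -> B != set0 ->
  ~~ zero_sum_mod m (m * n) x y B.

Lemma card_zero_sumfree : (#|A| <= m + m * n - 2)%N.
Proof.
rewrite leqNgt; apply/negP => ltA.
have [|B [sBA nzB]] := @davenport_rank2 m n m_gt0 n_gt0 I x y A.
  by nia.
by apply/negP/zsf.
Qed.

Hypothesis leA : (m + m * n - 2 <= #|A|)%N.

(** A term in pG is a block by itself. With q = m/p, the other terms, at least m + mn - 3 of them,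
    give q + qn - 2 more blocks, one too many in total. *)
Lemma long_zero_sumfree_indivisible p i : prime p -> (p %| m)%N -> i \in A ->
  ~~ ((p %| x i) && (p %| y i))%N.
Proof.
move=> p_pr /dvdnP[q Dm] Ai; apply/negP => pxy; have p_gt1 := prime_gt1 p_pr.
have q_gt0 : (0 < q)%N by move: m_gt0; rewrite Dm muln_gt0 => /andP[].
have [|B [sBA nzB]] := has_blocks_davenport (x := x) (y := y) (A := A)
    (ltnW p_gt1) (ltnW p_gt1) (davenport_rank2 q_gt0 n_gt0).
  have cA := cardsD1 i A; rewrite Ai in cA.
  have -> : (q + q * n).-1 = (q + q * n - 2).+1 by nia.
  apply: (@has_blocksS _ _ _ [set i]); rewrite ?sub1set //.
  - by apply/set0Pn; exists i; rewrite inE.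
  - by rewrite /zero_sum_mod !big_set1.
  by apply: has_blocks_prime => //; nia.
rewrite mulnA [(p * q)%N]mulnC -Dm.
by apply/negP/zsf.
Qed.

(** Here H is C_m + C_(md) with d = n/b, and G/H is C_b. If m terms lay in H, these singletons and
    md - 1 blocks of length at most b from the other mn - 2 or more terms would reach D(H) = m + md
    - 1. *)
Lemma long_zero_sumfree_few_divisible b : (1 < b)%N -> (b %| n)%N ->
  (#|[set i in A | (b %| y i)%N]| < m)%N.
Proof.
move=> b_gt1 /dvdnP[d Dn]; rewrite ltnNge; apply/negP => lem.
have d_gt0 : (0 < d)%N by move: n_gt0; rewrite Dn muln_gt0 => /andP[].
have [C /subsetP sC cC] := exists_subset_card lem.
have sCA : C \subset A by apply/subsetP => i /sC; rewrite inE => /andP[].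
have [|B [sBA nzB]] := has_blocks_davenport (x := x) (y := y) (A := A)
    (ltn0Sn 0) (ltnW b_gt1) (davenport_rank2 m_gt0 d_gt0).
  have -> : (m + m * d).-1 = (#|C| + (m * d).-1)%N by nia.
  apply: has_blocks_singletons => //.
    by move=> i /sC; rewrite inE /zero_sum_mod !big_set1 dvd1n => /andP[].
  apply: has_blocks_cyclic; first exact: ltnW.
  rewrite cardsDS // cC.
  by rewrite -subn1 mulnBl mul1n -mulnA -Dn; lia.
rewrite mul1n mulnCA [(b * d)%N]mulnC -Dn.
by apply/negP/zsf.
Qed.

End LongSequences.

(** * Coordinates on the group, orders and the final count *)

Lemma dvdn_div_gcd k t z : (0 < k)%N -> (k %| t * z)%N ->
  (k %/ gcdn t k %| z)%N.
Proof.
move=> k_gt0; have g_gt0 : (0 < gcdn t k)%N by rewrite gcdn_gt0 k_gt0 orbT.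
rewrite -[in X in (X %| _)%N -> _](divnK (dvdn_gcdr t k)).
rewrite -[in X in (_ %| X * _)%N -> _](divnK (dvdn_gcdl t k)).
rewrite [(_ * _ * z)%N]mulnAC dvdn_pmul2r // Gauss_dvdr //.
rewrite /coprime -(eqn_pmul2r g_gt0) muln_gcdl.
by rewrite !divnK ?dvdn_gcdl ?dvdn_gcdr // gcdnC mul1n.
Qed.

Lemma sum_Zp_eq0 r (I : finType) (z : I -> 'Z_r) (B : {set I}) : (0 < r)%N ->
    (forall i, z i \in Zp r) ->
  (\sum_(i in B) z i == 0) = (r %| \sum_(i in B) val (z i))%N.
Proof.
case: r z => [|[|r]] // z _ zZ.
  (* For r = 1 the type has two elements; only membership in [Zp 1] forces the terms to be zero. *)
  by rewrite dvd1n big1 ?eqxx // => i _; apply/eqP; have := zZ i; rewrite inE.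
rewrite -[in LHS](eq_bigr _ (fun i _ => natr_Zp (z i))) -natr_sum Zp_nat.
by rewrite -val_eqE.
Qed.

(** One choice of coordinates serves all families [u]: the terms of [S], and constant families,
    which detect orders. *)
Lemma cyclic_sum_coordinates r s (G : finZmodType) :
    (0 < r)%N -> (0 < s)%N -> [set: G] \isog cyclic_sum r s ->
  exists x y : G -> nat, forall (I : finType) (u : I -> G) (B : {set I}),
    zero_sum_mod r s (x \o u) (y \o u) B = (\sum_(i in B) u i == 0).
Proof.
move=> r_gt0 s_gt0 /isogP[f injf imf].
have fH g : ((f g).1 \in Zp r) && ((f g).2 \in Zp s).
  have : f g \in cyclic_sum r s by rewrite -imf mem_morphim ?inE.
  by rewrite inE.
have fM g h : f (g + h) = (f g * f h)%g by rewrite -morphM ?inE.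
have f1 : f 0 = 1%g := morph1 f.
exists (fun g => val (f g).1), (fun g => val (f g).2) => I u B.
rewrite /zero_sum_mod -!sum_Zp_eq0 //; try by move=> i; case/andP: (fH (u i)).
have -> : \sum_(i in B) (f (u i)).1 = (f (\sum_(i in B) u i)).1.
  by symmetry; apply: (big_morph (fun g => (f g).1)) => [g h|]; rewrite ?fM ?f1.
have -> : \sum_(i in B) (f (u i)).2 = (f (\sum_(i in B) u i)).2.
  by symmetry; apply: (big_morph (fun g => (f g).2)) => [g h|]; rewrite ?fM ?f1.
by rewrite -(morph_injm_eq1 injf) ?inE.
Qed.

(* n / e counts the multiples j < n of a divisor e of n; exchanging the two
   sums leaves, for each j, the number of i with o i dividing m * j. *)
Lemma sum_divn_order (I : finType) m n (o : I -> nat) :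
    (0 < m)%N -> (0 < n)%N ->
    (forall i, m %| o i)%N -> (forall i, o i %| m * n)%N ->
    (forall j, 0 < j < n -> #|[set i | o i %| m * j]| < m)%N ->
  (\sum_i (m * n) %/ o i <= #|I| + n.-1 * m.-1)%N.
Proof.
move=> m_gt0 n_gt0 mo omn few.
have le_count i : ((m * n) %/ o i <= \sum_(j < n) (o i %| m * j)%N)%N.
  have /dvdnP[e] := mo i; rewrite mulnC => De.
  have := omn i; rewrite De dvdn_pmul2l // => /dvdnP[c Dc].
  have := n_gt0; rewrite Dc muln_gt0 => /andP[c_gt0 e_gt0]; rewrite -Dc.
  rewrite divnMl // [in X in (X %/ _)%N]Dc mulnK //.
  have lt_ke (k : 'I_c) : (k * e < n)%N by rewrite Dc ltn_pmul2r.
  have inj_ke : injective (fun k => Ordinal (lt_ke k)).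
    by move=> k l [/eqP]; rewrite eqn_pmul2r // => /eqP/ord_inj.
  rewrite -[X in (X <= _)%N]card_ord -(card_imset predT inj_ke).
  rewrite -sum1_card big_mkcond.
  apply: leq_sum => j _; case: imsetP => // -[k _ ->].
  by rewrite /= dvdn_pmul2l // dvdn_mull.
apply: (@leq_trans (\sum_i \sum_(j < n) (o i %| m * j)))%N.
  by apply: leq_sum => i _; apply: le_count.
rewrite exchange_big.
case: n n_gt0 omn few {le_count} => // n _ _ few.
(* j = 0 counts every index; each other j counts at most m - 1. *)
rewrite big_ord_recl leq_add //.
  by rewrite -sum1_card leq_sum // => i _; apply: leq_b1.
apply: leq_trans (_ : \sum_(j < n) m.-1 <= _)%N; last first.
  by rewrite sum_nat_const card_ord.
apply: leq_sum => j _; have := few (lift ord0 j) (ltn_ord (lift ord0 j)).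
rewrite -[in X in _ -> X]ltnS prednK // -sum1dep_card big_mkcond.
by congr (_ <= _)%N; apply: eq_bigr => i _; case: dvdn.
Qed.

Theorem theorem2p4 (m n : nat) (m_gt0 : (0 < m)%N) (n_gt0 : (0 < n)%N)
    (G : finZmodType) (isoG : [set: G] \isog cyclic_sum m (m * n))
    (S : seq G) (zsfS : zero_sumfree S)
    (sizeS : (m + m * n - 2 <= size S)%N) :
  cross_number S <= (m%:R - 1) / m%:R + ((m * n)%:R - 1) / (m * n)%:R
  /\ cross_number S < 2.
Proof.
have mn_gt0 : (0 < m * n)%N by rewrite muln_gt0 m_gt0.
have [x [y xyE]] := cyclic_sum_coordinates m_gt0 mn_gt0 isoG.
pose I := 'I_(size S); pose u (i : I) := S`_i.
pose o i := #[u i]%g.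
have zsf (B : {set I}) : B \subset setT -> B != set0 ->
    ~~ zero_sum_mod m (m * n) (x \o u) (y \o u) B.
  by move=> _ nzB; rewrite xyE; apply: zsfS.
have leT : (m + m * n - 2 <= #|[set: I]|)%N by rewrite cardsT card_ord.
have oE i t : (o i %| t)%N = (m %| t * x (u i))%N && (m * n %| t * y (u i))%N.
  rewrite order_dvdn FinRing.zmodXgE.
  have := xyE 'I_t (fun=> u i) setT.
  by rewrite /zero_sum_mod /= !sum_nat_const sumr_const cardsT card_ord => <-.
(* Otherwise q = m / gcd([o i], m) exceeds 1 and divides both coordinates, so a prime factor of q
   puts the term in pG. *)
have mo i : (m %| o i)%N.
  have /andP[xo yo] : (m %| o i * x (u i))%N && (m * n %| o i * y (u i))%N.
    by rewrite -oE.
  have {}yo := dvdn_trans (dvdn_mulr n (dvdnn m)) yo.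
  have [xq yq] := (dvdn_div_gcd m_gt0 xo, dvdn_div_gcd m_gt0 yo).
  set q := (m %/ _)%N in xq yq.
  have Dm : m = (q * gcdn (o i) m)%N by rewrite divnK ?dvdn_gcdr.
  have q_gt0 : (0 < q)%N by move: m_gt0; rewrite {1}Dm muln_gt0 => /andP[].
  case: (ltnP 1 q) => [q_gt1|q_le1]; last first.
    have q1 : q = 1%N by apply/eqP; rewrite eqn_leq q_le1.
    by rewrite Dm q1 mul1n dvdn_gcdl.
  have pm : (pdiv q %| m)%N.
    by apply: dvdn_trans (pdiv_dvd q) _; rewrite [X in (_ %| X)%N]Dm dvdn_mulr.
  have /negP[] := long_zero_sumfree_indivisible m_gt0 n_gt0 zsf leT
    (pdiv_prime q_gt1) pm (in_setT i).
  by rewrite /= !(dvdn_trans (pdiv_dvd q)).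
have omn i : (o i %| m * n)%N.
  by rewrite oE (dvdn_mulr (y (u i)) (dvdnn _)) andbT -mulnA dvdn_mulr.
(* If [o i] divides mj, then b = n / gcd(j, n) divides the second coordinate, and b > 1 because 0 <
   j < n. *)
have few j : (0 < j < n)%N -> (#|[set i | o i %| m * j]| < m)%N.
  case/andP=> j_gt0 lt_jn; set b := (n %/ gcdn j n)%N.
  have g_gt0 : (0 < gcdn j n)%N by rewrite gcdn_gt0 j_gt0.
  have b_gt1 : (1 < b)%N.
    rewrite -(ltn_pmul2r g_gt0) mul1n divnK ?dvdn_gcdr //.
    by apply: leq_ltn_trans lt_jn; apply: dvdn_leq (dvdn_gcdl _ _).
  have bn : (b %| n)%N.
    by rewrite -[X in (_ %| X)%N](divnK (dvdn_gcdr j n)) dvdn_mulr.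
  apply: leq_ltn_trans (long_zero_sumfree_few_divisible m_gt0 n_gt0 zsf leT
    b_gt1 bn).
  apply/subset_leq_card/subsetP => i; rewrite !inE oE -!mulnA dvdn_pmul2l //.
  by case/andP=> _; apply: dvdn_div_gcd.
have leS : (size S <= m + m * n - 2)%N.
  by have := card_zero_sumfree m_gt0 n_gt0 zsf; rewrite cardsT card_ord.
have := sum_divn_order m_gt0 n_gt0 mo omn few; rewrite card_ord => le_sum.
have Ecn : cross_number S
    = (\sum_i ((m * n) %/ o i))%:R / (m * n)%:R.
  rewrite /cross_number (big_nth 0) big_mkord natr_sum mulr_suml.
  apply: eq_bigr => i _; have oi_gt0 : (0 < o i)%N := order_gt0 _.
  rewrite -[in RHS](divnK (omn i)) mulnK // natrM invfM mulVKf //.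
  by rewrite pnatr_eq0 -lt0n divn_gt0 // dvdn_leq.
have m0 : (0 : rat) < m%:R by rewrite ltr0n.
have n0 : (0 : rat) < n%:R by rewrite ltr0n.
have le_cn : cross_number S <=
    (m%:R - 1) / m%:R + ((m * n)%:R - 1) / (m * n)%:R.
  rewrite Ecn; have -> : (m%:R - 1) / m%:R + ((m * n)%:R - 1) / (m * n)%:R
      = (2 * (m * n)%:R - n%:R - 1) / (m * n)%:R :> rat.
    by rewrite natrM; field; rewrite !lt0r_neq0.
  rewrite ler_pM2r ?invr_gt0 ?ltr0n //.
  (* Indeed (m + mn - 2) + (n - 1)(m - 1) = 2mn - n - 1. *)
  suff : (\sum_i (m * n) %/ o i + n + 1 <= 2 * (m * n))%N.
    by rewrite -(ler_nat rat) !natrD !natrM; lra.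
  move: (\sum_i _)%N leS le_sum => s leS le_sum.
  by have := prednK m_gt0; have := prednK n_gt0; nia.
split=> //; apply: le_lt_trans le_cn _.
rewrite !mulrBl !divff ?pnatr_eq0 -?lt0n // !mul1r.
have : (0 : rat) < m%:R^-1 by rewrite invr_gt0.
have : (0 : rat) < (m * n)%:R^-1 by rewrite invr_gt0 ltr0n.
lra.
Qed.
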